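(* Let $E$ be a Banach lattice, let $E^*$ be its topological dual and $E^{\diamond}$ its $un$-dual. Then: (1) If $E^*$ has order continuous norm, then $E^* = E^{\diamond}$. (2) $E^{\diamond}$ is an ideal in $E^*$. (3) If $E$ is an $AM$-space, then $E^{\diamond}$ is an $AL$-space.
   Context: A net $(x_\alpha)$ in a Banach lattice $E$ is $un$-convergent to $x$, written $x_\alpha \xrightarrow{un} x$, if $\| |x_\alpha - x| \wedge u \| \to 0$ for every $u \in E^+$. A linear functional $f:E\to\mathbb{R}$ is $un$-continuous if $f(x_\alpha)\to 0$ for every norm bounded net $(x_\alpha)\subseteq E$ with $x_\alpha \xrightarrow{un} 0$. The $un$-dual $E^{\diamond}$ of $E$ is the vector space of all $un$-continuous functionals on $E$; it is a subspace of the topological dual $E^*$ and is equipped with the norm $\|f\|_{E^{\diamond}} = \sup\{|f(x)| : x\in E,\ \|x\|_E\le 1\}$. ''Ideal'' means order ideal of the Banach lattice $E^*$. *)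

(* Defs.v *)
From HB Require Import structures.
From mathcomp Require Import all_boot all_order all_algebra.
From mathcomp Require Import lra.
From mathcomp Require Import boolp classical_sets functions reals topology.
From mathcomp Require Import normedtype.
Set Implicit Arguments.
Unset Strict Implicit.
Unset Printing Implicit Defensive.
Import Order.TTheory GRing.Theory Num.Theory.
Import numFieldNormedType.Exports.
Local Open Scope classical_set_scope.
Local Open Scope ring_scope.

(* The order is carried by the mixin, and turned into a library lattice only
   afterwards, because Hierarchy-Builder rejects a structure that joins
   CompleteNormedModule and Order.Lattice below the predefined numeric ones. *)
HB.mixin Record CompleteNormedModule_isBanachLattice (R : realType) (E : Type)
    of CompleteNormedModule R E := {
  ble : rel E;
  bjoin : E -> E -> E;
  bmeet : E -> E -> E;
  ble_refl : reflexive ble;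
  ble_anti : antisymmetric ble;
  ble_trans : transitive ble;
  ble_meet : forall x y z : E, ble x (bmeet y z) = ble x y && ble x z;
  ble_join : forall x y z : E, ble (bjoin x y) z = ble x z && ble y z;
  bleD2r : forall z x y : E, ble x y -> ble (x + z) (y + z);
  bleZ : forall (a : R) (x y : E), 0 <= a -> ble x y -> ble (a *: x) (a *: y);
  ble_norm : forall x y : E,
    ble (bjoin x (- x)) (bjoin y (- y)) -> `|x| <= `|y|
}.

#[short(type="banachLatticeType")]
HB.structure Definition BanachLattice (R : realType) :=
  {E of CompleteNormedModule R E & CompleteNormedModule_isBanachLattice R E}.

Section BanachLatticeOrder.
Variables (R : realType) (E : banachLatticeType R).

HB.instance Definition _ := @Order.Le_isPOrder.Build ring_display
  (BanachLattice.sort E) ble ble_refl ble_anti ble_trans.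
HB.instance Definition _ := @Order.POrder_MeetJoin_isLattice.Build ring_display
  (BanachLattice.sort E) bmeet bjoin ble_meet ble_join.

End BanachLatticeOrder.

Definition labs (R : realType) (E : banachLatticeType R) (x : E) : E :=
  Order.join x (- x).

Section BanachLatticeTheory.
Variables (R : realType) (E : banachLatticeType R).
Implicit Types (x y z : E) (a : R).

Lemma bl_leD2r z x y : x <= y -> x + z <= y + z.
Proof. exact: bleD2r. Qed.

Lemma bl_leD2rE z x y : (x + z <= y + z) = (x <= y).
Proof.
apply/idP/idP; last exact: bl_leD2r.
by move=> /(bl_leD2r (- z)); rewrite !addrK.
Qed.

Lemma bl_leD x y z t : x <= y -> z <= t -> x + z <= y + t.
Proof.
move=> xy zt; apply: (le_trans (bl_leD2r z xy)).
by rewrite addrC [y + t]addrC; exact: bl_leD2r.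
Qed.

Lemma bl_subr_ge0 x y : (0 <= y - x) = (x <= y).
Proof. by rewrite -(bl_leD2rE x 0) add0r subrK. Qed.

Lemma bl_addr_ge0 x y : 0 <= x -> 0 <= y -> 0 <= x + y.
Proof. by move=> x0 y0; rewrite -[0]addr0; exact: bl_leD. Qed.

Lemma bl_ler_subl x y : (x - y <= x) = (0 <= y).
Proof. by rewrite -(bl_leD2rE y) subrK -{1}(addr0 x) ![x + _]addrC bl_leD2rE. Qed.

Lemma bl_leN x y : (- x <= - y) = (y <= x).
Proof. by rewrite -(bl_subr_ge0 (- x)) opprK addrC bl_subr_ge0. Qed.

Lemma bl_scale_ge0 a x : 0 <= a -> 0 <= x -> 0 <= a *: x.
Proof. by move=> a0 x0; have := @bleZ _ E _ _ _ a0 x0; rewrite scaler0. Qed.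

Lemma bl_leZ a x y : 0 <= a -> x <= y -> a *: x <= a *: y.
Proof. exact: bleZ. Qed.

Lemma bl_ge0_double x : 0 <= x + x -> 0 <= x.
Proof.
have -> : x + x = 2 *: x by rewrite scaler_nat mulr2n.
move=> xx; have := @bl_scale_ge0 2^-1 _ _ xx; rewrite invr_ge0 ler0n.
by move=> /(_ erefl); rewrite scalerA mulVf ?pnatr_eq0// scale1r.
Qed.

Lemma le_labs x : x <= labs x. Proof. exact: leUl. Qed.

Lemma leN_labs x : - x <= labs x. Proof. exact: leUr. Qed.

Lemma labs_ge0 x : 0 <= labs x.
Proof.
apply: bl_ge0_double; rewrite -(subrr x).
exact: (bl_leD (le_labs x) (leN_labs x)).
Qed.

Lemma labs_le x y : (labs x <= y) = (x <= y) && (- x <= y).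
Proof. exact: leUx. Qed.

Lemma ge0_labs x : 0 <= x -> labs x = x.
Proof.
move=> x0; apply/le_anti; rewrite le_labs andbT labs_le lexx /=.
by apply: (le_trans _ x0); rewrite -oppr0 bl_leN.
Qed.

Lemma ler_labs_norm x y : labs x <= labs y -> `|x| <= `|y|.
Proof. exact: ble_norm. Qed.

Lemma norm_labs x : `|labs x| = `|x|.
Proof.
by apply/le_anti; rewrite !ler_labs_norm//= (ge0_labs (labs_ge0 x)).
Qed.

Lemma labs_le_norm x y : labs x <= y -> `|x| <= `|y|.
Proof.
move=> xy; apply: ler_labs_norm.
by rewrite (ge0_labs (le_trans (labs_ge0 x) xy)).
Qed.

Lemma bl_le_norm x y : 0 <= x -> x <= y -> `|x| <= `|y|.
Proof. by move=> x0 xy; apply: labs_le_norm; rewrite ge0_labs. Qed.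

Definition lpos x : E := Order.join x 0.

Lemma lpos_ge0 x : 0 <= lpos x. Proof. exact: leUr. Qed.

Lemma le_lpos x : x <= lpos x. Proof. exact: leUl. Qed.

Lemma norm_lpos x : `|lpos x| <= `|x|.
Proof.
rewrite -(norm_labs x); apply: bl_le_norm; first exact: lpos_ge0.
by rewrite leUx le_labs labs_ge0.
Qed.

Lemma lpos_decomp x : exists y, [/\ 0 <= y, x = lpos x - y & `|y| <= `|x|].
Proof.
exists (lpos x - x); split; first by rewrite bl_subr_ge0 le_lpos.
  by rewrite opprB addrCA subrr addr0.
rewrite -(norm_labs x); apply: bl_le_norm.
  by rewrite bl_subr_ge0 le_lpos.
rewrite -(bl_leD2rE x) subrK leUx; apply/andP; split.
  by rewrite -{1}(add0r x) bl_leD2rE labs_ge0.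
by have := bl_leD2r x (leN_labs x); rewrite addNr.
Qed.

Lemma riesz_decomposition u x y : 0 <= u -> u <= x + y -> 0 <= x -> 0 <= y ->
  exists u1 u2, [/\ u = u1 + u2, 0 <= u1 <= x & 0 <= u2 <= y].
Proof.
move=> u0 uxy x0 y0; exists (Order.meet u x), (u - Order.meet u x); split.
- by rewrite addrCA subrr addr0.
- by rewrite lexI u0 x0 leIr.
- rewrite bl_subr_ge0 leIl /= -(bl_leD2rE (Order.meet u x)) subrK.
  rewrite addrC -(bl_leD2rE (- y)) addrK lexI; apply/andP; split.
    by rewrite -(bl_leD2rE y) subrK -{1}(addr0 u) addrC [u + y]addrC bl_leD2rE.
  by rewrite -(bl_leD2rE y) subrK.
Qed.

End BanachLatticeTheory.

Section Dual.
Variables (R : realType) (E : normedModType R).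

(* Scalar-valued functionals are given the codomain R^o, i.e. R as a normed
   module over itself. *)
Record dual : Type := Dual {
  dual_fun :> E -> R^o ;
  dual_linear : linear dual_fun ;
  dual_continuous : continuous dual_fun }.

Implicit Types f g h : dual.

HB.instance Definition _ := gen_eqMixin dual.
HB.instance Definition _ := gen_choiceMixin dual.

HB.instance Definition _ f :=
  GRing.isLinear.Build R E R^o *:%R (dual_fun f) (dual_linear f).

Lemma dualP f g : (forall x, f x = g x) -> f = g.
Proof.
case: f g => [f fl fc] [g gl gc] /= /funext fg.
case: _ / fg gl gc => gl gc.
by rewrite (Prop_irrelevance fl gl) (Prop_irrelevance fc gc).
Qed.

Fact dual_add_linear f g : linear (fun x => f x + g x).
Proof. by move=> a x y; rewrite !linearP scalerDr addrACA. Qed.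
Fact dual_add_continuous f g : continuous (fun x => f x + g x).
Proof. by move=> x; apply: cvgD; exact: dual_continuous. Qed.
Definition dual_add f g :=
  Dual (dual_add_linear f g) (@dual_add_continuous f g).

Fact dual_scale_linear (a : R) f : linear (fun x => a *: f x).
Proof. by move=> b x y; rewrite linearP scalerDr !scalerA mulrC. Qed.
Fact dual_scale_continuous (a : R) f : continuous (fun x => a *: f x).
Proof. by move=> x; apply: cvgZr; exact: dual_continuous. Qed.
Definition dual_scale a f :=
  Dual (dual_scale_linear a f) (@dual_scale_continuous a f).

Fact dual_zero_linear : linear (fun _ : E => 0 : R^o).
Proof. by move=> a x y; rewrite scaler0 addr0. Qed.
Fact dual_zero_continuous : continuous (fun _ : E => 0 : R^o).
Proof. by move=> x; exact: cvg_cst. Qed.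
Definition dual_zero := Dual dual_zero_linear dual_zero_continuous.

Fact dual_addA : associative dual_add.
Proof. by move=> f g h; apply: dualP => x /=; rewrite addrA. Qed.
Fact dual_addC : commutative dual_add.
Proof. by move=> f g; apply: dualP => x /=; rewrite addrC. Qed.
Fact dual_add0 : left_id dual_zero dual_add.
Proof. by move=> f; apply: dualP => x /=; rewrite add0r. Qed.
Fact dual_addN : left_inverse dual_zero (dual_scale (- 1)) dual_add.
Proof. by move=> f; apply: dualP => x /=; rewrite scaleN1r addNr. Qed.

HB.instance Definition _ :=
  GRing.isZmodule.Build dual dual_addA dual_addC dual_add0 dual_addN.

Fact dual_scaleA (a b : R) f : dual_scale a (dual_scale b f) = dual_scale (a * b) f.
Proof. by apply: dualP => x /=; rewrite scalerA. Qed.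
Fact dual_scale1 : left_id 1 dual_scale.
Proof. by move=> f; apply: dualP => x /=; rewrite scale1r. Qed.
Fact dual_scaleDr : right_distributive dual_scale +%R.
Proof. by move=> a f g; apply: dualP => x /=; rewrite scalerDr. Qed.
Fact dual_scaleDl f : {morph dual_scale^~ f : a b / a + b}.
Proof. by move=> a b; apply: dualP => x /=; rewrite scalerDl. Qed.

HB.instance Definition _ := GRing.Zmodule_isLmodule.Build R dual
  dual_scaleA dual_scale1 dual_scaleDr dual_scaleDl.

Lemma dualD f g x : (f + g) x = f x + g x. Proof. by []. Qed.
Lemma dualZ (a : R) f x : (a *: f) x = a * f x. Proof. by []. Qed.
Lemma dualN f x : (- f) x = - f x.
Proof. by rewrite -scaleN1r dualZ mulN1r. Qed.
Lemma dualB f g x : (f - g) x = f x - g x.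
Proof. by rewrite dualD dualN. Qed.
Lemma dual0 x : (0 : dual) x = 0. Proof. by []. Qed.

Lemma dual_appD f x y : f (x + y) = f x + f y. Proof. exact: linearD. Qed.
Lemma dual_appB f x y : f (x - y) = f x - f y. Proof. exact: linearB. Qed.
Lemma dual_appN f x : f (- x) = - f x. Proof. exact: linearN. Qed.
Lemma dual_app0 f : f 0 = 0. Proof. exact: linear0. Qed.
Lemma dual_appZ (a : R) f x : f (a *: x) = a * f x.
Proof. exact: linearZ. Qed.

Definition dual_norm f : R := sup [set `|f x| | x in [set x | `|x| <= 1]].

Lemma dual_bounded f : exists2 M, 0 <= M & forall x, `|f x| <= M * `|x|.
Proof.
have /linear_bounded_continuous/linear_boundedP := @dual_continuous f.
by move=> /pinfty_ex_gt0[M M0 fM]; exists M; first exact: ltW.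
Qed.

Fact dual_norm_has_sup f :
  has_sup [set `|f x| | x in [set x | `|x| <= 1]].
Proof.
split; first by exists `|f 0|, 0 => //=; rewrite normr0.
have [M M0 fM] := dual_bounded f; exists M => _ [x /= x1 <-].
by apply: (le_trans (fM x)); rewrite ler_piMr.
Qed.

Lemma dual_norm_ge0 f : 0 <= dual_norm f.
Proof.
have := sup_upper_bound (dual_norm_has_sup f); move=> /(_ `|f 0|).
by rewrite linear0 normr0; apply; exists 0; rewrite /= ?linear0 normr0.
Qed.

Lemma dual_le_norm f x : `|f x| <= dual_norm f * `|x|.
Proof.
have [->|x0] := eqVneq x 0; first by rewrite linear0 !normr0 mulr0.
have nx : 0 < `|x| by rewrite normr_gt0.
have := sup_upper_bound (dual_norm_has_sup f).
move=> /(_ `|f (`|x|^-1 *: x)|); rewrite linearZ normrM ger0_norm ?invr_ge0//.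
rewrite ler_pdivrMl// [X in _ -> _ <= X]mulrC; apply.
exists (`|x|^-1 *: x) => /=.
  by rewrite normrZ ger0_norm ?invr_ge0// mulVf ?gt_eqF.
by rewrite linearZ normrM ger0_norm ?invr_ge0.
Qed.

Lemma dual_norm_le f M :
  (forall x, `|f x| <= M * `|x|) -> 0 <= M -> dual_norm f <= M.
Proof.
move=> fM M0; apply: ge_sup; first by case: (dual_norm_has_sup f).
by move=> _ [x /= x1 <-]; apply: (le_trans (fM x)); rewrite ler_piMr.
Qed.

Fact dual_normD f g : dual_norm (f + g) <= dual_norm f + dual_norm g.
Proof.
apply: dual_norm_le => [x|]; last by rewrite addr_ge0 ?dual_norm_ge0.
rewrite dualD (le_trans (ler_normD _ _))// mulrDl.
by rewrite lerD ?dual_le_norm.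
Qed.

Fact dual_normZ_le (a : R) f : dual_norm (a *: f) <= `|a| * dual_norm f.
Proof.
apply: dual_norm_le => [x|]; last by rewrite mulr_ge0 ?dual_norm_ge0.
by rewrite dualZ normrM -mulrA ler_wpM2l ?dual_le_norm.
Qed.

Fact dual_normZ (a : R) f : dual_norm (a *: f) = `|a| * dual_norm f.
Proof.
apply/le_anti; rewrite dual_normZ_le /=.
have [->|a0] := eqVneq a 0; first by rewrite normr0 mul0r dual_norm_ge0.
rewrite -ler_pdivlMl ?normr_gt0// -normfV.
by rewrite -{1}(scale1r f) -(mulVf a0) -scalerA dual_normZ_le.
Qed.

Fact dual_norm0_eq0 f : dual_norm f = 0 -> f = 0.
Proof.
move=> f0; apply: dualP => x; apply/eqP.
by rewrite -normr_le0 (le_trans (dual_le_norm f x))// f0 mul0r.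
Qed.

HB.instance Definition _ := Lmodule_isNormed.Build R dual
  dual_normD dual_normZ dual_norm0_eq0.

Lemma dual_normE f :
  `|f| = sup [set `|f x| | x in [set x | `|x| <= 1]].
Proof. by []. Qed.

Lemma ler_dual_norm f x : `|f x| <= `|f| * `|x|.
Proof. exact: dual_le_norm. Qed.

Lemma ge_dual_norm f M :
  (forall x, `|f x| <= M * `|x|) -> 0 <= M -> `|f| <= M.
Proof. exact: dual_norm_le. Qed.

Fact dual_bound_continuous (f : E -> R^o) (M : R) :
  linear f -> (forall x, `|f x| <= M * `|x|) -> continuous f.
Proof.
move=> fl fM.
pose f' := HB.pack_for {linear E -> R^o} f
  (GRing.isLinear.Build R E R^o *:%R f fl).
rewrite -[f]/(f' : E -> R^o); apply/linear_bounded_continuous.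
apply/linear_boundedP; near=> r => x.
rewrite (le_trans (fM x))// ler_wpM2r//; near: r.
by apply: nbhs_pinfty_ge; exact: num_real.
Unshelve. all: by end_near. Qed.

End Dual.

Section DualComplete.
Variables (R : realType) (E : normedModType R).

Lemma dual_complete (F : set_system (dual E)) :
  ProperFilter F -> cauchy F -> cvg F.
Proof.
move=> FF /cauchyP Fc.
have Fe (e : R) : 0 < e -> exists f0 : dual E, F [set f | `|f0 - f| < e].
  move=> e0; have [f0 Ff0] := Fc e e0.
  by exists f0; move: Ff0; rewrite -ball_normE.
pose ev x := (fun f : dual E => f x : R) @ F.
have evP x (e : R) : 0 < e -> exists f0 : dual E, ev x [set r | `|f0 x - r| <= e * `|x|].
  move=> e0; have [f0 Ff0] := Fe e e0; exists f0.
  rewrite /ev /=; apply: filterS Ff0 => f /= ff0.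
  rewrite -dualB (le_trans (ler_dual_norm _ _))// ler_wpM2r//.
  exact: ltW.
have cvev x : cvg (ev x).
  apply: cauchy_cvg; apply: (@cauchy_exP R) => e e0.
  have d0 : 0 < e / (1 + `|x|) by rewrite divr_gt0// ltr_pwDl.
  have [f0 evf0] := evP x _ d0; exists (f0 x : R).
  rewrite -ball_normE /=.
  apply: filterS evf0 => r /= rf0; apply: (le_lt_trans rf0).
  by rewrite -mulrAC ltr_pdivrMr ?ltr_pwDl// ltr_pM2l// ltrDr.
pose l x : R^o := lim (ev x).
have lP x : (fun f : dual E => f x : R) @ F --> (l x : R) by exact: cvev.
have ll : linear l.
  move=> a x y; apply: (@cvg_lim R (@norm_hausdorff R R)).
  rewrite /ev [X in X @ F](_ : _ = fun f : dual E => a * f x + f y : R).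
    by apply: cvgD; [apply: cvgMr; exact: lP|exact: lP].
  by apply/funext => f; rewrite linearP.
have lE (e : R) : 0 < e ->
    F [set f : dual E | forall x, `|f x - l x| <= e * `|x|].
  move=> e0; have e20 : 0 < e / 2 by rewrite divr_gt0.
  have [f0 Ff0] := Fe _ e20.
  apply: filterS (Ff0) => f /= ff0 x.
  have : closed_ball_ Num.norm (f x : R) (e * `|x|) (l x).
    apply: (@closed_cvg _ R F _ (fun g : dual E => g x : R) _
      (@closed_closed_ball_ R R (f x) _) _ _ (lP x)).
    apply: filterS Ff0 => g /= gf0.
    rewrite /closed_ball_/= -dualB (le_trans (ler_dual_norm _ _))// ler_wpM2r//.
    rewrite (_ : f - g = (f0 - g) - (f0 - f)); last first.
      by rewrite opprB [RHS]addrC addrA subrK.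
    by rewrite (le_trans (ler_normB _ _))// [leRHS]splitr lerD// ltW.
  by [].
have [f1 f1P] := filter_ex (lE 1 ltr01).
have lc : continuous l.
  apply: (@dual_bound_continuous _ _ l (1 + `|f1|)) => // x.
  rewrite mulrDl -[l x](subrKC (f1 x)) addrC.
  rewrite (le_trans (ler_normD _ _))// lerD ?ler_dual_norm//.
  by rewrite distrC.
apply/cvg_ex; exists (Dual ll lc); apply/cvgrPdist_le => e e0.
apply: filterS (lE e e0) => f fl; apply: ge_dual_norm; last exact: ltW.
by move=> x; rewrite dualB distrC.
Qed.

HB.instance Definition _ := Uniform_isComplete.Build (dual E) dual_complete.

End DualComplete.

Section DualLattice.
Variables (R : realType) (E : banachLatticeType R).
Implicit Types (x y u v : E) (f g h : dual E).

Definition dual_le f g : bool := `[< forall x, 0 <= x -> f x <= g x >].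

Fact dual_le_refl : reflexive dual_le.
Proof. by move=> f; apply/asboolP. Qed.

Lemma dual_ext f g : (forall x, 0 <= x -> f x = g x) -> f = g.
Proof.
move=> fg; apply: dualP => x; have [y [y0 -> _]] := lpos_decomp x.
by rewrite !dual_appB !fg// lpos_ge0.
Qed.

Fact dual_le_anti : antisymmetric dual_le.
Proof.
move=> f g /andP[/asboolP fg /asboolP gf]; apply: dual_ext => x x0.
by apply/le_anti; rewrite fg ?gf.
Qed.

Fact dual_le_trans : transitive dual_le.
Proof.
move=> g f h /asboolP fg /asboolP gh; apply/asboolP => x x0.
by apply: le_trans (gh _ x0); exact: fg.
Qed.

Fact dual_leD2r h f g : dual_le f g -> dual_le (f + h) (g + h).
Proof.
move=> /asboolP fg; apply/asboolP => x x0.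
by rewrite !dualD lerD2r fg.
Qed.

Fact dual_leZ (a : R) f g : 0 <= a -> dual_le f g -> dual_le (a *: f) (a *: g).
Proof.
move=> a0 /asboolP fg; apply/asboolP => x x0.
by rewrite !dualZ ler_wpM2l// fg.
Qed.

Section Join.
Variables f g : dual E.

(* Riesz-Kantorovich formula:
   (f v g)(x) = sup {f y + g (x - y) | 0 <= y <= x} for x >= 0, extended by
   linearity along x = x^+ - x^-. *)
Definition rk_set x : set R := [set f y + g (x - y) | y in [set y | 0 <= y <= x]].
Definition rk_sup x : R := sup (rk_set x).

Let C : R := `|f| + `|g|.

Let C_ge0 : 0 <= C. Proof. by rewrite addr_ge0. Qed.

Let interval_bound x y : 0 <= y <= x -> `|f y + g (x - y)| <= C * `|x|.
Proof.
move=> /andP[y0 yx]; rewrite (le_trans (ler_normD _ _))// mulrDl lerD//.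
  rewrite (le_trans (ler_dual_norm _ _))// ler_wpM2l//; exact: bl_le_norm.
rewrite (le_trans (ler_dual_norm _ _))// ler_wpM2l//; apply: bl_le_norm.
  by rewrite bl_subr_ge0.
by rewrite bl_ler_subl.
Qed.

Let rk_has_sup x : 0 <= x -> has_sup (rk_set x).
Proof.
move=> x0; split; first by exists (f 0 + g (x - 0)), 0 => //=; rewrite lexx x0.
exists (C * `|x|) => _ [y yx <-]; apply: le_trans (ler_norm _) _.
exact: interval_bound.
Qed.

Let rk_sup_ub x y : 0 <= y <= x -> f y + g (x - y) <= rk_sup x.
Proof.
move=> yx; apply: (sup_upper_bound (rk_has_sup _)); last by exists y.
by case/andP: yx; exact: le_trans.
Qed.

Let rk_sup_le x M : 0 <= x ->
  (forall y, 0 <= y <= x -> f y + g (x - y) <= M) -> rk_sup x <= M.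
Proof.
move=> x0 xM; apply: ge_sup; first by case: (rk_has_sup x0).
by move=> _ [y yx <-]; exact: xM.
Qed.

Let rk_sup_norm x : 0 <= x -> `|rk_sup x| <= C * `|x|.
Proof.
move=> x0; rewrite ler_norml; apply/andP; split; last first.
  apply: rk_sup_le => // y yx; apply: le_trans (ler_norm _) _.
  exact: interval_bound.
have x00 : (0 : E) <= (0 : E) <= x by rewrite lexx x0.
apply: le_trans (rk_sup_ub x00).
by have := interval_bound x00; rewrite ler_norml => /andP[].
Qed.

Let rk_supD x y : 0 <= x -> 0 <= y -> rk_sup (x + y) = rk_sup x + rk_sup y.
Proof.
move=> x0 y0; apply/le_anti/andP; split.
  apply: rk_sup_le; first exact: bl_addr_ge0.
  move=> u /andP[u0 uxy].
  have [u1 [u2 [-> u1x u2y]]] := riesz_decomposition u0 uxy x0 y0.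
  rewrite opprD addrACA dual_appD (dual_appD g (x - u1)) addrACA.
  by rewrite lerD// rk_sup_ub.
rewrite -lerBrDr; apply: rk_sup_le => // u1 /andP[u10 u1x].
rewrite lerBrDr addrC -lerBrDr; apply: rk_sup_le => // u2 /andP[u20 u2y].
rewrite lerBrDr [leLHS]addrC addrACA -!dual_appD addrACA -opprD.
by apply: rk_sup_ub; rewrite bl_addr_ge0//=; exact: bl_leD.
Qed.

Let rk_supZ_ge (a : R) x : 0 <= a -> 0 <= x -> a * rk_sup x <= rk_sup (a *: x).
Proof.
move=> a0 x0; have [->|an0] := eqVneq a 0.
  rewrite mul0r scale0r; have z : (0 : E) <= (0 : E) <= (0 : E) by rewrite lexx.
  by have := rk_sup_ub z; rewrite subrr !dual_app0 addr0.
have ap : 0 < a by rewrite lt_def an0.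
rewrite -ler_pdivlMl//; apply: rk_sup_le => // y /andP[y0 yx].
rewrite ler_pdivlMl// mulrDr.
have -> : a * f y = f (a *: y) by rewrite dual_appZ.
have -> : a * g (x - y) = g (a *: x - a *: y) by rewrite -scalerBr dual_appZ.
by apply: rk_sup_ub; rewrite bl_scale_ge0//= bl_leZ.
Qed.

Let rk_supZ (a : R) x : 0 <= a -> 0 <= x -> rk_sup (a *: x) = a * rk_sup x.
Proof.
move=> a0 x0; apply/le_anti; rewrite rk_supZ_ge// andbT.
have [->|an0] := eqVneq a 0.
  rewrite mul0r scale0r; apply: rk_sup_le => // y /andP[y0 y0'].
  have -> : y = 0 by apply/le_anti; rewrite y0 y0'.
  by rewrite subrr !dual_app0 addr0.
have ap : 0 < a by rewrite lt_def an0.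
rewrite -ler_pdivrMl// (le_trans (rk_supZ_ge _ _)) ?invr_ge0//.
  exact: bl_scale_ge0.
by rewrite scalerA mulVf// scale1r.
Qed.

Definition rk_fun (x : E) : R^o := rk_sup (lpos x) - rk_sup (lpos x - x).

Let rk_funE u v : 0 <= u -> 0 <= v -> rk_fun (u - v) = rk_sup u - rk_sup v.
Proof.
move=> u0 v0; rewrite /rk_fun.
have : u - v <= lpos (u - v) by exact: le_lpos.
move: (lpos (u - v)) (lpos_ge0 (u - v)) => p p0 up.
have H : rk_sup p + rk_sup v = rk_sup u + rk_sup (p - (u - v)).
  rewrite -!rk_supD ?bl_subr_ge0//; congr rk_sup.
  by rewrite opprB addrCA [u + _]addrC subrK.
by rewrite -[rk_sup p](addrK (rk_sup v)) H addrAC addrK.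
Qed.

Let lpos_sub x : [/\ 0 <= lpos x, 0 <= lpos x - x & lpos x - (lpos x - x) = x].
Proof.
by split; rewrite ?lpos_ge0 ?bl_subr_ge0 ?le_lpos// opprB addrCA subrr addr0.
Qed.

Let rk_funD x y : rk_fun (x + y) = rk_fun x + rk_fun y.
Proof.
have [px nx xE] := lpos_sub x; have [py ny yE] := lpos_sub y.
rewrite -{1}xE -{1}yE addrACA -opprD rk_funE; [|exact: bl_addr_ge0..].
by rewrite (rk_supD px py) (rk_supD nx ny) opprD addrACA.
Qed.

Let rk_funZ_ge (a : R) x : 0 <= a -> rk_fun (a *: x) = a * rk_fun x.
Proof.
move=> a0; have [px nx xE] := lpos_sub x.
rewrite -{1}xE scalerBr rk_funE; [|exact: bl_scale_ge0..].
by rewrite !rk_supZ// -mulrBr.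
Qed.

Let rk_funN x : rk_fun (- x) = - rk_fun x.
Proof.
have [px nx xE] := lpos_sub x.
by rewrite -{1}xE opprB rk_funE// opprB.
Qed.

Fact rk_fun_linear : linear rk_fun.
Proof.
move=> a x y; rewrite rk_funD; congr (_ + _).
have [a0|/ltW a0] := leP 0 a; first exact: rk_funZ_ge.
rewrite -[in LHS](opprK a) scaleNr rk_funN rk_funZ_ge ?oppr_ge0//.
by rewrite mulNr opprK.
Qed.

Fact rk_fun_continuous : continuous rk_fun.
Proof.
apply: (@dual_bound_continuous _ _ _ (C + C)); first exact: rk_fun_linear.
move=> x; have [n [n0 xE nx]] := lpos_decomp x.
have -> : rk_fun x = rk_sup (lpos x) - rk_sup n.
  by rewrite {1}xE rk_funE ?lpos_ge0.
rewrite (le_trans (ler_normB _ _))// mulrDl.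
rewrite lerD// (le_trans (rk_sup_norm _)) ?lpos_ge0// ler_wpM2l//.
exact: norm_lpos.
Qed.

Definition dual_join : dual E := Dual rk_fun_linear rk_fun_continuous.

Lemma dual_joinE x : 0 <= x -> dual_join x = rk_sup x.
Proof.
move=> x0; rewrite /= -{1}(subr0 x) rk_funE//.
by rewrite -(scale0r (0 : E)) rk_supZ// mul0r subr0.
Qed.

Fact dual_join_le h : dual_le dual_join h = dual_le f h && dual_le g h.
Proof.
apply/asboolP/andP => [fgh|[/asboolP fh /asboolP gh] x x0].
  split; apply/asboolP => x x0; apply: le_trans (fgh x x0).
    rewrite dual_joinE//; have := @rk_sup_ub x x.
    by rewrite x0 lexx subrr dual_app0 addr0; exact.
  rewrite dual_joinE//; have := @rk_sup_ub x 0.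
  by rewrite x0 lexx subr0 dual_app0 add0r; exact.
rewrite dual_joinE//; apply: rk_sup_le => // y /andP[y0 yx].
have -> : h x = h y + h (x - y) by rewrite -dual_appD addrCA subrr addr0.
by rewrite lerD ?fh ?gh// bl_subr_ge0.
Qed.

Lemma dual_join_le_at x M : 0 <= x ->
  (forall y, 0 <= y <= x -> f y + g (x - y) <= M) -> dual_join x <= M.
Proof. by move=> x0; rewrite dual_joinE//; exact: rk_sup_le. Qed.

End Join.

Lemma dual_leN f g : dual_le (- f) (- g) = dual_le g f.
Proof.
by apply/asboolP/asboolP => fg x x0; have := fg x x0; rewrite !dualN lerN2.
Qed.

Definition dual_meet f g : dual E := - dual_join (- f) (- g).

Fact dual_meet_le h f g : dual_le h (dual_meet f g) = dual_le h f && dual_le h g.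
Proof.
by rewrite -{1}(opprK h) dual_leN dual_join_le !dual_leN.
Qed.

Lemma dual_le_labs f h x : dual_le f h -> dual_le (- f) h -> `|f x| <= h (labs x).
Proof.
move=> /asboolP fh /asboolP fNh.
have p1 : 0 <= labs x + x by rewrite -[x in _ + x]opprK bl_subr_ge0 leN_labs.
have p2 : 0 <= labs x - x by rewrite bl_subr_ge0 le_labs.
have := fh _ p1; have := fh _ p2; have := fNh _ p1; have := fNh _ p2.
rewrite !dualN !dual_appD !dual_appN /= ler_norml.
move: (f x) (f (labs x)) (h x) (h (labs x)) => a b c d h1 h2 h3 h4.
by apply/andP; split; lra.
Qed.

Fact dual_ler_norm f g :
  dual_le (dual_join f (- f)) (dual_join g (- g)) -> `|f| <= `|g|.
Proof.
move=> fg; apply: ge_dual_norm => // x.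
have := dual_le_refl (dual_join f (- f)).
rewrite dual_join_le => /andP[f1 f2].
apply: (le_trans (dual_le_labs x f1 f2)).
have /asboolP/(_ _ (labs_ge0 x)) := fg; move=> /le_trans; apply.
apply: dual_join_le_at; first exact: labs_ge0.
move=> y /andP[y0 yx]; rewrite dualN -dual_appB.
apply: le_trans (ler_norm _) _; apply: (le_trans (ler_dual_norm _ _)).
rewrite ler_wpM2l// -(norm_labs x); apply: labs_le_norm.
rewrite labs_le; apply/andP; split.
  rewrite opprB -[leRHS]addr0; apply: bl_leD => //.
  by rewrite -(bl_leD2rE (labs x)) subrK add0r.
by rewrite opprB; apply: (le_trans (y := labs x - y)); rewrite bl_ler_subl.
Qed.

HB.instance Definition _ := CompleteNormedModule_isBanachLattice.Build R (dual E)
  dual_le_refl dual_le_anti dual_le_trans dual_meet_le dual_join_le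
  dual_leD2r dual_leZ dual_ler_norm.

HB.instance Definition _ :=
  Order.Lattice.copy (dual E) (BanachLattice.sort (dual E)).

Lemma dual_leP f g : reflect (forall x, 0 <= x -> f x <= g x) (f <= g).
Proof. exact: asboolP. Qed.

End DualLattice.

(* Nets.  The index type of a net is an arbitrary nonempty directed preorder. *)
Definition directed (A : Type) (le : A -> A -> Prop) : Prop :=
  [/\ inhabited A,
      forall a, le a a,
      forall a b c, le a b -> le b c -> le a c &
      forall a b, exists2 c, le a c & le b c].

Definition tails (A : Type) (le : A -> A -> Prop) : set_system A :=
  [set S | exists a, forall b, le a b -> S b].

Lemma tails_proper_filter (A : Type) (le : A -> A -> Prop) :
  directed le -> ProperFilter (tails le).
Proof.
move=> [[a0] lexx le_trans dir]; split.
  by move=> [a /(_ a (lexx a))].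
split; first by exists a0.
- move=> P Q [a aP] [b bQ]; have [c ac bc] := dir a b.
  by exists c => d cd; split; [apply: aP|apply: bQ]; apply: le_trans cd.
- by move=> P Q PQ [a aP]; exists a => b ab; apply: PQ; exact: aP.
Qed.

Section UnboundedNorm.
Variables (R : realType) (E : banachLatticeType R).

Definition un_cvg (A : Type) (le : A -> A -> Prop) (x : A -> E) (l : E) : Prop :=
  forall u : E, 0 <= u ->
    `|Order.meet (labs (x a - l)) u| @[a --> tails le] --> (0 : R).

Definition un_continuous (f : E -> R) : Prop :=
  forall (A : Type) (le : A -> A -> Prop) (x : A -> E),
    directed le -> bounded_set (range x) -> un_cvg le x 0 ->
    f (x a) @[a --> tails le] --> (0 : R).

Lemma un_continuous_continuous (f : {linear E -> R^o}) :
  un_continuous f -> continuous f.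
Proof.
move=> fu; pose A := {p : R * E | `|p.2| <= p.1 /\ 0 < p.1 <= 1}.
pose le (p q : A) := (sval q).1 <= (sval p).1.
have mk (r : R) : 0 < r <= 1 -> exists p : A, (sval p).1 = r.
  move=> r01; have rP : `|(r, 0 : E).2| <= (r, 0 : E).1 /\ 0 < (r, 0 : E).1 <= 1.
    by rewrite /= normr0; split => //; case/andP: r01 => /ltW.
  by exists (exist _ (r, 0) rP).
have dir : directed le.
  split.
  - by have [|p _] := mk 1; [rewrite ltr01 lexx|exists].
  - by move=> p; exact: lexx.
  - by move=> p q s pq qs; exact: le_trans qs pq.
  - move=> p q; have [pq|/ltW qp] := leP (sval p).1 (sval q).1.
      by exists p => //; exact: lexx.
    by exists q => //; exact: lexx.
have FF := tails_proper_filter dir.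
have bnd : bounded_set (range (fun p : A => (sval p).2)).
  exists 1; split; first exact: num_real.
  move=> M M1 _ [[[r y] [/= yr /andP[_ r1]]] _ <-] /=.
  exact: le_trans yr (le_trans r1 (ltW M1)).
have un0 : un_cvg le (fun p : A => (sval p).2) 0.
  move=> u u0; apply/cvgrPdist_le => e e0.
  have [|p pE] := mk (Num.min e 1).
    by rewrite lt_min e0 ltr01 ge_min lexx orbT.
  exists p => q pq /=; rewrite sub0r normrN normr_id subr0.
  apply: (le_trans (y := (sval p).1)); last by rewrite pE ge_min lexx.
  apply: le_trans pq; apply: le_trans (proj1 (svalP q)).
  rewrite -[leRHS]norm_labs; apply: bl_le_norm; last exact: leIl.
  by rewrite lexI u0 labs_ge0.
have /cvgrPdist_le/(_ 1 ltr01)[p pP] := fu A le _ dir bnd un0.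
apply/linear_bounded_continuous/ex_bound; exists 1.
have /andP[p0 p1] := proj2 (svalP p).
apply/nbhs_norm0P; exists (sval p).1 => //= y /ltW yp.
have yP : `|((sval p).1, y).2| <= ((sval p).1, y).1 /\ 0 < ((sval p).1, y).1 <= 1.
  by split => //=; rewrite p0 p1.
have := pP (exist _ ((sval p).1, y) yP); rewrite /le /= sub0r normrN.
by apply; exact: lexx.
Qed.

(* By the previous lemma, no un-continuous linear functional is lost by
   considering only elements of the topological dual. *)
Definition un_dual : set (dual E) := [set f | un_continuous f].

Definition order_continuous_norm : Prop :=
  forall (A : Type) (le : A -> A -> Prop) (x : A -> E),
    directed le ->
    (forall a b, le a b -> x b <= x a) ->
    (forall a, 0 <= x a) ->
    (forall z, (forall a, z <= x a) -> z <= 0) ->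
    `|x a| @[a --> tails le] --> (0 : R).

Definition linear_subspace (A : set E) : Prop :=
  A 0 /\ forall (a : R) (x y : E), A x -> A y -> A (a *: x + y).

Definition order_ideal (A : set E) : Prop :=
  linear_subspace A /\ forall x y : E, A y -> labs x <= labs y -> A x.

(* With the operations, order and norm inherited from E, A is a Banach
   lattice. *)
Definition banach_sublattice (A : set E) : Prop :=
  [/\ linear_subspace A,
      forall x y, A x -> A y -> A (Order.join x y),
      forall x y, A x -> A y -> A (Order.meet x y) &
      forall F : set_system E, ProperFilter F -> F A -> cauchy F ->
        exists2 l, A l & F --> l].

Definition AL_subspace (A : set E) : Prop :=
  banach_sublattice A /\
  forall x y, A x -> A y -> 0 <= x -> 0 <= y -> `|x + y| = `|x| + `|y|.

Definition AM_space : Prop :=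
  forall x y : E, 0 <= x -> 0 <= y ->
    `|Order.join x y| = Num.max `|x| `|y|.

End UnboundedNorm.

Arguments un_dual {R} E.
Arguments order_continuous_norm {R} E.
Arguments AM_space {R} E.

(* Main.v *)
(* (1) Suppose that the dual norm is order continuous and f >= 0.  For all
   M, e > 0 there is u >= 0 with f((x - u)^+) < e whenever x >= 0 and
   |x| <= M; since z <= z /\ u + (z - u)^+, bounded un-null nets are then
   mapped by f to null nets.  If there were no such u, one could choose
   inductively x_n >= 0 in the M-ball, u_n = 2^n (x_0 + ... + x_(n-1)) and a
   component g_n of f with g_n(x_n) - g_n(u_n) = f((x_n - u_n)^+) >= e.  As
   g_n(u_n) <= |f| M, g_n(x_m) <= 2^-n |f| M for m < n.  Hence
   h_n = sup_(i >= n) g_i decreases to some l with l(x_m) <= 0 for all m, and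
   e <= g_n(x_n) <= h_n(x_n) <= |h_n - l| M, which contradicts order
   continuity.
   (2) If |f| <= |g| with g un-continuous, and (x_a) is a bounded un-null net,
   pick |y_a| <= |x_a| with |g|(|x_a|) <= g(y_a) + e; then (y_a) is a bounded
   un-null net too and |f(x_a)| <= g(y_a) + e.
   (3) The un-dual is a closed ideal, and in an AM-space, for f, g >= 0 and x, y
   in the unit ball, |f(x)| + |g(y)| <= (f + g)(|x| \/ |y|) <= |f + g|. *)
Require Import Defs.
From HB Require Import structures.
From mathcomp Require Import all_boot all_order all_algebra.
From mathcomp Require Import lra.
From mathcomp Require Import boolp classical_sets functions reals topology.
From mathcomp Require Import normedtype sequences.
Set Implicit Arguments.
Unset Strict Implicit.
Unset Printing Implicit Defensive.
Import Order.TTheory GRing.Theory Num.Theory.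
Import numFieldNormedType.Exports.
Local Open Scope classical_set_scope.
Local Open Scope ring_scope.

(** * Functionals built from their values on the positive cone: limits, suprema, components *)

Section ConeFunctionals.
Variables (R : realType) (E : banachLatticeType R).
Implicit Types (x y z u v w : E) (f g h : dual E).

Lemma dual_mono f x y : 0 <= f -> x <= y -> f x <= f y.
Proof.
move=> /dual_leP f0 xy; rewrite -subr_ge0 -dual_appB.
by have := f0 (y - x); rewrite bl_subr_ge0; apply.
Qed.

Lemma dual_ge0 f x : 0 <= f -> 0 <= x -> 0 <= f x.
Proof. by move=> /dual_leP f0 /f0. Qed.

Lemma lpos_sub_ge0 x : 0 <= lpos x - x.
Proof. by rewrite bl_subr_ge0 le_lpos. Qed.

Lemma dual_le_pos_norm f x c : 0 <= f -> `|x| <= c -> f x <= `|f| * c.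
Proof.
move=> f0 xc; apply: le_trans (ler_norm _) _.
by apply: (le_trans (ler_dual_norm _ _)); rewrite ler_wpM2l.
Qed.

(** The extension is [T (lpos x) - T (lpos x - x)]. Domination by [f] gives [|T w| <= |f| |w|] on
    the cone, hence continuity. Functionals defined by a limit or a supremum on the cone are
    obtained this way. *)
Lemma dual_of_cone (T : E -> R) f :
  (forall x y, 0 <= x -> 0 <= y -> T (x + y) = T x + T y) ->
  (forall (a : R) x, 0 < a -> 0 <= x -> T (a *: x) = a * T x) ->
  (forall x, 0 <= x -> 0 <= T x <= f x) ->
  exists h : dual E, forall x, 0 <= x -> h x = T x.
Proof.
move=> TD TZ Tf.
pose h x : R^o := T (lpos x) - T (lpos x - x).
have T0 : T 0 = 0 by have := Tf 0 (lexx 0); rewrite dual_app0 => /le_anti.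
(* By additivity the value does not depend on how [x] is written as a difference of two positive
   elements. *)
have hE u v : 0 <= u -> 0 <= v -> h (u - v) = T u - T v.
  move=> u0 v0; rewrite /h.
  have H : T (lpos (u - v)) + T v = T u + T (lpos (u - v) - (u - v)).
    rewrite -!TD ?lpos_ge0 ?lpos_sub_ge0//; congr T.
    by rewrite opprB addrCA [u + (v - u)]addrC subrK.
  by apply/eqP; rewrite subr_eq addrAC -H addrK.
have hB x : exists u v,
    [/\ 0 <= u, 0 <= v, x = u - v & `|u| + `|v| <= 2 * `|x|].
  have [v [v0 xE nv]] := lpos_decomp x; exists (lpos x), v.
  split; rewrite ?lpos_ge0// mulr2n mulrDl mul1r lerD//; exact: norm_lpos.
have hN x : h (- x) = - h x.
  have [u [v [u0 v0 -> _]]] := hB x.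
  by rewrite opprB !hE// opprB.
have hZ (a : R) x : 0 < a -> h (a *: x) = a * h x.
  move=> a0; have [u [v [u0 v0 -> _]]] := hB x.
  have az w : 0 <= w -> 0 <= a *: w by apply: bl_scale_ge0; exact: ltW.
  by rewrite scalerBr !hE ?az// !TZ// mulrBr.
have hl : linear h.
  move=> a x y.
  have -> : h (a *: x + y) = h (a *: x) + h y.
    have [u [v [u0 v0 -> _]]] := hB (a *: x); have [p [q [p0 q0 -> _]]] := hB y.
    rewrite addrACA -opprD !hE ?bl_addr_ge0// !TD//.
    by rewrite opprD addrACA.
  congr (_ + _); have [a0|a0|->] := ltgtP a 0.
  - by rewrite -[a]opprK scaleNr [RHS]scaleNr hN hZ ?oppr_gt0.
  - exact: hZ.
  - by rewrite !scale0r /h subr0 subrr.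
have hb x : `|h x| <= (`|f| * 2) * `|x|.
  have [u [v [u0 v0 -> uv]]] := hB x; rewrite hE//.
  have b w : 0 <= w -> `|T w| <= `|f| * `|w|.
    move=> /Tf /andP[Tw0 Twf]; rewrite ger0_norm//; apply: (le_trans Twf).
    exact: le_trans (ler_norm _) (ler_dual_norm _ _).
  apply: (le_trans (ler_normB _ _)); apply: (le_trans (lerD (b _ u0) (b _ v0))).
  by rewrite -mulrDr -mulrA ler_wpM2l.
exists (Dual hl (dual_bound_continuous hl hb)) => x x0 /=.
by rewrite -[in LHS](subr0 x) hE// T0 subr0.
Qed.

(** The pointwise limit on the cone is additive, positively homogeneous and lies between [0] and
    [k 0]. *)
Lemma dual_seq_inf (k : nat -> dual E) :
  (forall n, 0 <= k n) -> (forall n, k n.+1 <= k n) ->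
  exists h : dual E, [/\ 0 <= h, forall n, h <= k n &
    forall x, 0 <= x -> (k n x : R) @[n --> \oo] --> (h x : R)].
Proof.
move=> k0 kS; pose T x := limn (fun n => k n x : R).
have kdec x : 0 <= x -> nonincreasing_seq (fun n => k n x : R).
  by move=> x0; apply/nonincreasing_seqP => n; exact: (dual_leP _ _ (kS n)).
have kcvg x : 0 <= x -> cvgn (fun n => k n x : R).
  move=> x0; apply: nonincreasing_is_cvgn; first exact: kdec.
  by exists 0 => _ [n _ <-]; exact: dual_ge0.
have [x y x0 y0|a x a0 x0|x x0|h hT] := @dual_of_cone T (k 0%N).
- rewrite /T -limD; [|exact: kcvg..].
  by congr (limn _); apply/funext => n /=; rewrite dual_appD.
- rewrite /T (_ : (fun n => _) = (fun n => a * k n x)).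
    by apply/cvg_lim => //; apply: cvgM; [exact: cvg_cst|exact: kcvg].
  by apply/funext => n; rewrite dual_appZ.
- apply/andP; split.
    by apply: limr_ge; [exact: kcvg|near=> n; exact: dual_ge0].
  exact: (nonincreasing_cvgn_ge (kdec _ x0) (kcvg _ x0) 0%N).
exists h; split; last by move=> x x0; rewrite hT//; exact: kcvg.
  apply/dual_leP => x x0; rewrite hT//.
  by apply: limr_ge; [exact: kcvg|near=> n; exact: dual_ge0].
move=> n; apply/dual_leP => x x0; rewrite hT//.
exact: (nonincreasing_cvgn_ge (kdec _ x0) (kcvg _ x0) n).
Unshelve. all: by end_near. Qed.

(** The supremum is [f] minus the infimum of the decreasing sequence [f - J N], with [J N] the
    finite joins. The last clause holds because a finite join of positive functionals is at most
    their sum; it will be fed with geometric bounds. *)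
Lemma dual_seq_sup (g : nat -> dual E) f :
  (forall n, 0 <= g n) -> (forall n, g n <= f) ->
  exists s : dual E, [/\ forall n, g n <= s,
    forall t : dual E, 0 <= t -> (forall n, g n <= t) -> s <= t &
    forall x (c : R), 0 <= x -> (forall N, \sum_(i < N) g i x <= c) -> s x <= c].
Proof.
move=> g0 gf.
(* [J N] joins [0] with the terms of index below [N], so [g n] first enters at [n.+1]. *)
pose J := fix J N : dual E := if N is N'.+1 then Order.join (J N') (g N') else 0.
have J0 N : 0 <= J N.
  by elim: N => //= N IH; apply: le_trans IH _; exact: leUl.
have Jle t : 0 <= t -> (forall n, g n <= t) -> forall N, J N <= t.
  by move=> t0 gt; elim=> //= N IH; rewrite leUx IH gt.
have Jsum x N : 0 <= x -> J N x <= \sum_(i < N) g i x.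
  move=> x0; have /dual_leP/(_ x x0) : J N <= \sum_(i < N) g i.
    elim: N => [|N IH]; first by rewrite big_ord0.
    rewrite big_ord_recr /= leUx; apply/andP; split.
      by apply: (le_trans IH); rewrite -[leLHS]addr0 bl_leD.
    by rewrite -[leLHS]add0r bl_leD//; apply: le_trans (J0 N) IH.
  move=> /le_trans; apply; rewrite le_eqVlt; apply/orP; left; apply/eqP.
  elim/big_ind2: _ => // _ a _ b <- <-; exact: dualD.
have f0 : 0 <= f by exact: le_trans (g0 0%N) (gf 0%N).
have [n|n|l [l0 _ lP]] := @dual_seq_inf (fun N => f - J N).
- by rewrite bl_subr_ge0; exact: Jle.
- by rewrite -(bl_leD2rE (- f)) ![_ - _ - f]addrAC subrr !add0r bl_leN leUl.
have JP x : 0 <= x -> (J N x : R) @[N --> \oo] --> ((f - l) x : R).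
  move=> x0; rewrite (_ : (fun N => _) = (fun N => f x - (f - J N) x)).
    by rewrite dualB; apply: cvgB; [exact: cvg_cst|exact: lP].
  by apply/funext => N; rewrite dualB opprB addrCA subrr addr0.
have Jb x c : 0 <= x -> (forall N, J N x <= c) -> (f - l) x <= c.
  move=> x0 Jc; rewrite -(cvg_lim _ (JP x x0))//.
  apply: limr_le; first by apply/cvg_ex; exists ((f - l) x); exact: JP.
  by near=> N.
exists (f - l); split.
- move=> n; apply/dual_leP => x x0; rewrite -(cvg_lim _ (JP x x0))//.
  apply: limr_ge; first by apply/cvg_ex; exists ((f - l) x); exact: JP.
  exists n.+1 => // N /=; elim: N => // N IH.
  rewrite ltnS leq_eqVlt => /orP[/eqP <-|/IH/le_trans]; last apply.
    by apply: (dual_leP _ _ _ x x0); exact: leUr.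
  by apply: (dual_leP _ _ _ x x0); exact: leUl.
- move=> t t0 gt; apply/dual_leP => x x0; apply: Jb => // N.
  by apply: (dual_leP _ _ _ x x0); exact: Jle.
- by move=> x c x0 xc; apply: Jb => // N; apply: (le_trans (Jsum x N x0)).
Unshelve. all: by end_near. Qed.

(* [f ((x - u)^+)] is the value at [x - u] of a component of [f], namely
   [f] restricted to the ideal generated by [(x - u)^+]. *)
Lemma dual_lpos_attained f x u : 0 <= f ->
  exists2 g : dual E, 0 <= g <= f & f (lpos (x - u)) = g x - g u.
Proof.
move=> f0; pose y := lpos (x - u); pose n := y - (x - u).
have y0 : 0 <= y by exact: lpos_ge0.
have n0 : 0 <= n by exact: lpos_sub_ge0.
(* [sup (S z)] is the value at [z] of the restriction of [f] to the ideal generated by [y]. It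
   agrees with [f] at [y] and will vanish at [n]. *)
pose S z : set R := [set f w | w in
  [set w | 0 <= w <= z /\ exists2 k : R, 0 <= k & w <= k *: y]].
have Sub z : 0 <= z -> ubound (S z) (f z).
  by move=> z0 _ [w [/andP[w0 wz] _] <-]; exact: dual_mono.
have Ssup z : 0 <= z -> has_sup (S z).
  move=> z0; split; last by exists (f z); exact: Sub.
  by exists (f 0), 0 => //; rewrite /= lexx z0; split=> //; exists 0; rewrite ?scale0r.
have Sup z w k : 0 <= k -> 0 <= w -> w <= z -> w <= k *: y -> f w <= sup (S z).
  move=> k0 w0 wz wk; apply: sup_upper_bound; first exact: Ssup (le_trans w0 wz).
  by exists w => //; split; [rewrite w0 wz|exists k].
have SZ a z : 0 < a -> 0 <= z -> a * sup (S z) <= sup (S (a *: z)).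
  move=> a0 z0; have a0' := ltW a0; rewrite -ler_pdivlMl//; apply: ge_sup; first by case: (Ssup z z0).
  move=> _ [w [/andP[w0 wz] [k k0 wk]] <-]; rewrite ler_pdivlMl// -dual_appZ.
  apply: (@Sup _ _ (a * k)); rewrite ?mulr_ge0 ?bl_scale_ge0 ?bl_leZ//.
  by rewrite -scalerA bl_leZ.
have [z t z0 t0|a z a0 z0|z z0|g gS] := @dual_of_cone (fun z => sup (S z)) f.
- apply/le_anti/andP; split.
    apply: ge_sup; first by case: (Ssup _ (bl_addr_ge0 z0 t0)).
    move=> _ [w [/andP[w0 wz] [k k0 wk]] <-].
    have [w1 [w2 [wE /andP[w10 w1z] /andP[w20 w2t]]]] :=
      riesz_decomposition w0 wz z0 t0.
    rewrite wE dual_appD lerD//; apply: (@Sup _ _ k) => //; apply: le_trans wk.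
      by rewrite wE -[leLHS]addr0 bl_leD.
    by rewrite wE -[leLHS]add0r bl_leD.
  rewrite -lerBrDr; apply: ge_sup; first by case: (Ssup _ z0).
  move=> _ [w [/andP[w0 wz] [k k0 wk]] <-].
  rewrite lerBrDr addrC -lerBrDr; apply: ge_sup; first by case: (Ssup _ t0).
  move=> _ [v [/andP[v0 vt] [l l0 vl]] <-].
  rewrite lerBrDr addrC -dual_appD; apply: (@Sup _ _ (k + l)).
  + exact: addr_ge0.
  + exact: bl_addr_ge0.
  + exact: bl_leD.
  + by rewrite scalerDl bl_leD.
- have a0' := ltW a0; apply/le_anti; rewrite SZ// andbT -ler_pdivrMl//.
  apply: (le_trans (SZ _ _ _ _)); rewrite ?invr_gt0 ?bl_scale_ge0//.
  by rewrite scalerA mulVf ?gt_eqF// scale1r.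
- apply/andP; split; last first.
    by apply: ge_sup; [case: (Ssup z z0)|exact: Sub].
  by have := @Sup z 0 0; rewrite dual_app0 scale0r; apply.
exists g.
  apply/andP; split; apply/dual_leP => z z0; rewrite gS//.
    by have := @Sup z 0 0; rewrite dual_app0 scale0r; apply.
  by apply: ge_sup; [case: (Ssup z z0)|exact: Sub].
have gy : g y = f y.
  rewrite gS//; apply/le_anti/andP; split.
    by apply: ge_sup; [case: (Ssup y y0)|exact: Sub].
  by apply: (@Sup _ _ 1); rewrite ?scale1r.
(* [y] and [n] are the positive and negative parts of [x - u], hence disjoint: [y - w] still
   dominates both [x - u] and [0], so it dominates [y]. *)
have disj w : 0 <= w -> w <= y -> w <= n -> w = 0.
  move=> w0 wy wn; apply/le_anti; rewrite w0 andbT.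
  have : y <= y - w.
    rewrite {1}/y leUx bl_subr_ge0 wy andbT.
    by rewrite -bl_subr_ge0 addrAC bl_subr_ge0.
  by rewrite -{1}(subr0 y) -(bl_leD2rE (- y)) ![y - _ - y]addrAC subrr !add0r bl_leN.
have gn : g n = 0.
  rewrite gS//; apply/le_anti/andP; split; last first.
    by have := @Sup n 0 0; rewrite dual_app0 scale0r; apply.
  apply: ge_sup; first by case: (Ssup n n0).
  move=> _ [w [/andP[w0 wn] [k k0 wk]] <-].
  have k1 : 0 < 1 + k by rewrite ltr_pwDl.
  (* The factor [1 + k] serves both bounds: [w <= k *: y] and [w <= n] put the rescaled [w] below
     [y] and below [n]. *)
  have : (1 + k)^-1 *: w = 0.
    have iw t : w <= (1 + k) *: t -> (1 + k)^-1 *: w <= t.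
      move=> wt; rewrite -[leRHS]scale1r -[X in _ <= X *: t](mulVf (lt0r_neq0 k1)) -scalerA.
      by rewrite bl_leZ// invr_ge0 ltW.
    apply: disj; first by rewrite bl_scale_ge0// invr_ge0 ltW.
      apply: iw; apply: (le_trans wk).
      by rewrite scalerDl -[leLHS]add0r bl_leD// bl_scale_ge0.
    apply: iw; apply: (le_trans wn).
    by rewrite scalerDl scale1r -[leLHS]addr0 bl_leD// bl_scale_ge0.
  move/(congr1 (fun t => f ((1 + k) *: t))).
  by rewrite scalerA mulfV ?gt_eqF// scale1r scaler0 dual_app0 => ->.
rewrite -dual_appB -/y -gy -[LHS]subr0 -gn -dual_appB; congr (g _).
by rewrite opprB addrCA subrr addr0.
Qed.

End ConeFunctionals.

(** * The un-dual: the order continuous case, solidity and norm closedness *)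

Section UnDual.
Variables (R : realType) (E : banachLatticeType R).
Implicit Types (x y z u v w : E) (f g h : dual E).

Lemma dual_ler_labs f x : `|f x| <= labs f (labs x).
Proof. by apply: dual_le_labs; [exact: le_labs|exact: leN_labs]. Qed.

Lemma sum_geometric_half_le (a : R) n N : 0 <= a ->
  \sum_(i < N) a * 2^-1 ^+ (n + i) <= a * 2 * 2^-1 ^+ n.
Proof.
move=> a0; suff -> : \sum_(i < N) a * 2^-1 ^+ (n + i) =
    a * 2 * 2^-1 ^+ n - a * 2 * 2^-1 ^+ (n + N).
  by rewrite gerBl !mulr_ge0// exprn_ge0 ?invr_ge0.
elim: N => [|N IH]; first by rewrite big_ord0 addn0 subrr.
by rewrite big_ord_recr /= IH addnS exprS; lra.
Qed.

Lemma ocn_dual_almost_order_bounded f (M e : R) :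
  order_continuous_norm (dual E) -> 0 <= f -> 0 < e ->
  exists2 u : E, 0 <= u &
    forall x, 0 <= x -> `|x| <= M -> f (lpos (x - u)) < e.
Proof.
move=> ocn f0 e0; apply: contrapT => noU.
(* Positivity of [u] sits under the existential so that [choice] gives a total function; [(0, 0)] is
   the default value elsewhere. *)
have H u : exists p : E * dual E, 0 <= u ->
    [/\ 0 <= p.1, `|p.1| <= M, 0 <= p.2 <= f & e <= p.2 p.1 - p.2 u].
  have [u0|nu] := pselect (is_true (0 <= u)); last by exists (0, 0).
  apply: contrapT => np; apply: noU; exists u => // x x0 xM.
  rewrite ltNge; apply/negP => ef; apply: np.
  have [g gf gE] := dual_lpos_attained x u f0.
  by exists (x, g) => _ /=; split; rewrite -?gE.
have [P PP] := choice H.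
pose s := fix s n : E := if n is m.+1 then s m + (P (2 ^+ m *: s m)).1 else 0.
pose U n : E := 2 ^+ n *: s n; pose x n := (P (U n)).1; pose g n := (P (U n)).2.
have two0 n : 0 <= 2 ^+ n :> R by rewrite exprn_ge0.
have s0 n : 0 <= s n.
  elim: n => [|n IH]; first exact: lexx.
  rewrite /= bl_addr_ge0//; have [] // := PP (2 ^+ n *: s n).
  exact: bl_scale_ge0.
have {}PP n : [/\ 0 <= x n, `|x n| <= M, 0 <= g n <= f & e <= g n (x n) - g n (U n)].
  by apply: PP; exact: bl_scale_ge0.
have x0 n : 0 <= x n by have [] := PP n.
have xM n : `|x n| <= M by have [] := PP n.
have M0 : 0 <= M by apply: le_trans (xM 0%N).
have g0 n : 0 <= g n by have [_ _ /andP[]] := PP n.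
have gf n : g n <= f by have [_ _ /andP[]] := PP n.
have ge n : e <= g n (x n) - g n (U n) by have [] := PP n.
pose C : R := `|f| * M; have C0 : 0 <= C by rewrite mulr_ge0.
(* Since [x m <= s n], one gets [2 ^+ n * g n (x m) <= g n (U n) <= g n (x n) - e <= C]. *)
have gx m n : (m < n)%N -> g n (x m) <= C * 2^-1 ^+ n.
  move=> mn; have xs : x m <= s n.
    elim: n mn => // n IH; rewrite ltnS leq_eqVlt => /orP[/eqP <-|/IH xs] /=.
      by rewrite -[leLHS]add0r bl_leD.
    by apply: (le_trans xs); rewrite -[leLHS]addr0 bl_leD//; exact: x0.
  apply: (le_trans (dual_mono (g0 n) xs)).
  rewrite exprVn ler_pdivlMr ?exprn_gt0// mulrC -dual_appZ -/(U n).
  have gxC : g n (x n) <= C.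
    apply: le_trans (dual_le_pos_norm f0 (xM n)).
    exact: (dual_leP _ _ (gf n)).
  by have := ge n; lra.
(* The tail suprema; the shift [n + i] turns each tail into a sequence starting at [0]. *)
have [h hP] := choice (fun n => @dual_seq_sup _ _ (fun i => g (n + i)%N) f
  (fun i => g0 _) (fun i => gf _)).
have gh m n : (n <= m)%N -> g m <= h n.
  by move=> nm; rewrite -(subnKC nm); have [] := hP n.
have h0 n : 0 <= h n by apply: le_trans (g0 n) (gh _ _ _).
have hdec m n : (m <= n)%N -> h n <= h m.
  move=> mn; have [_ + _] := hP n; apply => [|i]; first exact: h0.
  by apply: gh; rewrite (leq_trans mn)// leq_addr.
have hx m n : (m < n)%N -> h n (x m) <= C * 2 * 2^-1 ^+ n.
  move=> mn; have [_ _] := hP n; apply; first exact: x0.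
  move=> N; apply: le_trans (sum_geometric_half_le n N C0).
  by apply: ler_sum => i _; apply: gx; rewrite (leq_trans mn)// leq_addr.
have [//|l [l0 lh lP]] := @dual_seq_inf _ _ h h0; first by move=> n; exact: hdec.
have lx m : l (x m) <= 0.
  have cv : (geometric (C * 2) 2^-1 : nat -> R) @ \oo --> (0 : R).
    by apply: cvg_geometric; rewrite ger0_norm ?invr_ge0//; lra.
  rewrite -(cvg_lim _ cv)//; apply: limr_ge; first by apply/cvg_ex; exists 0.
  exists m.+1 => // n /= mn; apply: le_trans (hx _ _ mn).
  exact: (dual_leP _ _ (lh n)).
have dir : directed (fun m n : nat => (m <= n)%N).
  split; [exact: inhabits 0%N|exact: leqnn|by move=> a b c; exact: leq_trans|].
  by move=> a b; exists (maxn a b); rewrite ?leq_maxl ?leq_maxr.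
have FF := tails_proper_filter dir.
have hl0 n : 0 <= h n - l by rewrite bl_subr_ge0.
have : `|h n - l| @[n --> tails (fun m n : nat => (m <= n)%N)] --> (0 : R).
  apply: ocn => // [a b ab|z zh].
    by apply: bl_leD2r; exact: hdec.
  (* [h n - l] has infimum [0] because [h n y] tends to [l y] on the cone: [z y + l y <= h n y]
     passes to the limit. *)
  apply/dual_leP => y y0.
  have zl n : z y <= h n y - l y.
    by rewrite -dualB; exact: (dual_leP _ _ (zh n)).
  suff : z y + l y <= l y by rewrite gerDr.
  rewrite -[leRHS](cvg_lim _ (lP y y0))//.
  apply: limr_ge; first by apply/cvg_ex; exists (l y); exact: lP.
  by near=> n; move: (zl n); rewrite lerBrDr.
(* [M] may be [0], hence the division by [M + 1]. *)
have M1 : 0 < M + 1 by rewrite ltr_wpDl.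
move/cvgrPdist_lt => /(_ (e / (M + 1))); rewrite divr_gt0// => /(_ isT)[n].
move=> /(_ n (leqnn n)); rewrite sub0r normrN normr_id ltr_pdivlMr// => hle.
have hx1 : h n (x n) - l (x n) <= `|h n - l| * M by rewrite -dualB dual_le_pos_norm.
have hx2 : g n (x n) <= h n (x n) by apply: (dual_leP _ _ (gh _ _ (leqnn n))).
have hx3 : 0 <= g n (U n) by rewrite dual_ge0// bl_scale_ge0.
have := ge n; have := lx n; have := normr_ge0 (h n - l); lra.
Unshelve. all: by end_near. Qed.

(** [x - lpos (x - u)] lies below both [x] and [u]. *)
Lemma bl_le_meet_add_lpos x u : x <= Order.meet x u + lpos (x - u).
Proof.
rewrite -(bl_leD2rE (- lpos (x - u))) addrK lexI bl_ler_subl lpos_ge0 /=.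
rewrite -(bl_leD2rE (lpos (x - u))) subrK -(bl_leD2rE (- u)).
by rewrite [u + _]addrC addrK le_lpos.
Qed.

Lemma net_bound (A : Type) (x : A -> E) :
  bounded_set (range x) -> exists2 M : R, 0 < M & forall a, `|x a| <= M.
Proof.
move=> /pinfty_ex_gt0[M M0 xM]; exists M => // a.
by apply: xM; exists a.
Qed.

Lemma un_continuousP (f : E -> R) :
  (forall (A : Type) (le : A -> A -> Prop) (x : A -> E) (M e : R),
    directed le -> (forall a, `|x a| <= M) -> un_cvg le x 0 -> 0 < M -> 0 < e ->
    \forall a \near tails le, `|f (x a)| <= e) -> un_continuous f.
Proof.
move=> H A le x dir /net_bound[M M0 xM] ux.
have FF := tails_proper_filter dir.
apply/cvgrPdist_le => e e0.
by apply: filterS (H A le x M e dir xM ux M0 e0) => a; rewrite sub0r normrN.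
Qed.

Lemma ocn_un_dual f : order_continuous_norm (dual E) -> un_dual E f.
Proof.
move=> ocn; apply: un_continuousP => A le x M e dir xM ux M0 e0.
have FF := tails_proper_filter dir.
have e20 : 0 < e / 2 by rewrite divr_gt0.
have F0 := labs_ge0 f.
have [u u0 uM] := @ocn_dual_almost_order_bounded (labs f) M (e / 2) ocn F0 e20.
have d0 : 0 < e / 2 / (`|labs f| + 1) by rewrite divr_gt0// ltr_wpDl.
have /cvgrPdist_le/(_ _ d0) := ux u u0; apply: filterS => a.
rewrite subr0 sub0r normrN normr_id ler_pdivlMr ?ltr_wpDl// => mle.
apply: (le_trans (dual_ler_labs f (x a))).
apply: (le_trans (dual_mono F0 (bl_le_meet_add_lpos (labs (x a)) u))).
rewrite dual_appD [leRHS]splitr lerD//.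
  apply: (le_trans (dual_le_pos_norm F0 (lexx _))).
  by apply: le_trans mle; rewrite mulrC ler_wpM2l// lerDl.
by apply/ltW/uM; rewrite ?labs_ge0 ?norm_labs.
Qed.

(* [|g| z = sup {g y | |y| <= z}] for [z >= 0]. *)
Lemma labs_dual_approx g z (e : R) : 0 <= z -> 0 < e ->
  exists2 y, labs y <= z & labs g z <= g y + e.
Proof.
move=> z0 e0; apply: contrapT => noy.
suff : labs g z <= labs g z - e by move: e0; lra.
apply: dual_join_le_at => // y /andP[y0 yz].
(* The Riesz-Kantorovich terms for [labs g z] are [g y - g (z - y)] with [0 <= y <= z], which is [g]
   at [y - (z - y)], an element of modulus at most [z]. *)
rewrite leNgt; apply/negP => ylt; apply: noy; exists (y - (z - y)).
  rewrite labs_le; apply/andP; split.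
    by apply: (le_trans _ yz); rewrite bl_ler_subl bl_subr_ge0.
  by rewrite opprB; apply: (le_trans (y := z - y)); rewrite bl_ler_subl.
by rewrite dual_appB -dualN; move/ltW: ylt; rewrite lerBlDr.
Qed.

Lemma un_dual_solid f g : un_dual E g -> labs f <= labs g -> un_dual E f.
Proof.
move=> ug fg; apply: un_continuousP => A le x M e dir xM ux M0 e0.
have FF := tails_proper_filter dir.
have e20 : 0 < e / 2 by rewrite divr_gt0.
have /choice[y yP] : forall a, exists y,
    labs y <= labs (x a) /\ labs g (labs (x a)) <= g y + e / 2.
  move=> a; have [y] := labs_dual_approx g (labs_ge0 (x a)) e20.
  by exists y.
have yx a : labs (y a) <= labs (x a) by have [] := yP a.
have /cvgrPdist_le/(_ _ e20) : g (y a) @[a --> tails le] --> (0 : R).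
  apply: ug => //.
    exists M; split=> [|N MN _ [a _ <-]]; first exact: num_real.
    by apply: le_trans (ltW MN); apply: le_trans (xM a); exact: ler_labs_norm.
  move=> u u0; apply: squeeze_cvgr (cvg_cst 0) (ux u u0).
  near=> a; rewrite normr_ge0 /= !subr0; apply: bl_le_norm.
    by rewrite lexI labs_ge0.
  by rewrite lexI leIr andbT; apply: le_trans (yx a); exact: leIl.
apply: filterS => a; rewrite sub0r normrN => gy.
apply: (le_trans (dual_ler_labs f (x a))).
apply: (le_trans (dual_leP _ _ fg _ (labs_ge0 (x a)))).
apply: (le_trans (proj2 (yP a))); rewrite [leRHS]splitr lerD2r.
exact: le_trans (ler_norm _) gy.
Unshelve. all: by end_near. Qed.

Lemma un_dual_subspace : linear_subspace (un_dual E).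
Proof.
split=> [|a f g uf ug] A le x dir bx ux; have FF := tails_proper_filter dir.
  exact: cvg_cst.
have -> : 0 = a * 0 + 0 :> R by rewrite mulr0 addr0.
by apply: cvgD; [apply: cvgM; [exact: cvg_cst|exact: uf]|exact: ug].
Qed.

Lemma un_dual_ideal : order_ideal (un_dual E).
Proof. by split; [exact: un_dual_subspace|exact: un_dual_solid]. Qed.

(** On a net bounded by [M], a functional [f] of the un-dual within [e / 2 / M] of [l] differs from
    [l] by at most [e / 2], uniformly along the net. *)
Lemma un_dual_closed (F : set_system (dual E)) (l : dual E) :
  ProperFilter F -> F (un_dual E) -> F --> l -> un_dual E l.
Proof.
move=> FF FA Fl; apply: un_continuousP => A le x M e dir xM ux M0 e0.
have FT := tails_proper_filter dir.
have e20 : 0 < e / 2 by rewrite divr_gt0.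
have d0 : 0 < e / 2 / M by rewrite divr_gt0.
have FB : F (ball l (e / 2 / M)) by apply: Fl; exact: nbhsx_ballx.
have /filter_ex[f [uf]] : F (un_dual E `&` ball l (e / 2 / M)) by exact: filterI.
rewrite -ball_normE /= ltr_pdivlMr// => lf.
have bx : bounded_set (range x).
  exists M; split=> [|N MN _ [a _ <-]]; first exact: num_real.
  exact: le_trans (xM a) (ltW MN).
have /cvgrPdist_le/(_ _ e20) := uf A le x dir bx ux.
apply: filterS => a; rewrite sub0r normrN => fx.
rewrite -[l](subrK f) dualD (le_trans (ler_normD _ _))// [leRHS]splitr lerD//.
apply: (le_trans (ler_dual_norm _ _)); apply: le_trans (ltW lf).
by rewrite ler_wpM2l.
Qed.

End UnDual.

(** * Lattice operations in ideals, and additivity of the dual norm over an AM-space *)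

Section Ideals.
Variables (R : realType) (E : banachLatticeType R).
Implicit Types (x y : E) (A : set E).

(** The modulus of the join is at most [labs x + labs y], which lies in the ideal. *)
Lemma order_ideal_join A x y :
  order_ideal A -> A x -> A y -> A (Order.join x y).
Proof.
move=> [[A0 AP] sol] Ax Ay.
have Aabs z : A z -> A (labs z).
  by move=> Az; apply: (sol _ z) => //; rewrite (ge0_labs (labs_ge0 z)).
have /(sol (Order.join x y)) : A (labs x + labs y).
  by rewrite -[labs x]scale1r; apply: AP; exact: Aabs.
apply; rewrite (ge0_labs (bl_addr_ge0 (labs_ge0 x) (labs_ge0 y))).
have xl : labs x <= labs x + labs y by rewrite -[leLHS]addr0 bl_leD// labs_ge0.
have yl : labs y <= labs x + labs y by rewrite -[leLHS]add0r bl_leD// labs_ge0.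
rewrite labs_le leUx (le_trans (le_labs x) xl) (le_trans (le_labs y) yl) /=.
rewrite -(opprK (labs x + labs y)) bl_leN; apply: le_trans (leUl _ _).
by rewrite -[leRHS]opprK bl_leN (le_trans (leN_labs x) xl).
Qed.

Lemma order_ideal_meet A x y :
  order_ideal A -> A x -> A y -> A (Order.meet x y).
Proof.
move=> idA Ax Ay; have [[A0 AP] _] := idA.
have AN z : A z -> A (- z).
  by move=> Az; rewrite -scaleN1r -[X in A X]addr0; exact: AP.
have -> : Order.meet x y = - Order.join (- x) (- y).
  apply/le_anti/andP; split.
    rewrite -[leLHS]opprK bl_leN leUx !bl_leN.
    by rewrite leIl leIr.
  rewrite lexI -{2}(opprK x) -{3}(opprK y) !bl_leN.
  by rewrite leUl leUr.
by apply: (AN); apply: order_ideal_join => //; exact: AN.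
Qed.

Lemma AM_space_dual_normD (f g : dual E) : AM_space E ->
  0 <= f -> 0 <= g -> `|f + g| = `|f| + `|g|.
Proof.
move=> AM f0 g0; apply/le_anti; rewrite ler_normD /=.
have labsE (h : dual E) z : 0 <= h -> `|h z| <= h (labs z).
  by move=> h0; have := dual_ler_labs h z; rewrite (ge0_labs h0).
(* The two dual norms are suprema over the unit ball; they are unfolded one after the other to reach
   independent points [x] and [y]. *)
rewrite -lerBrDr (dual_normE f); apply: ge_sup; first by case: (dual_norm_has_sup f).
move=> _ [x /= x1 <-]; rewrite lerBrDr addrC -lerBrDr (dual_normE g).
apply: ge_sup; first by case: (dual_norm_has_sup g).
move=> _ [y /= y1 <-]; rewrite lerBrDr addrC.
pose z := Order.join (labs x) (labs y).
have z1 : `|z| <= 1 by rewrite AM ?labs_ge0// !norm_labs ge_max x1.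
apply: le_trans (_ : (f + g) z <= _); last first.
  by rewrite -[leRHS]mulr1; apply: dual_le_pos_norm => //; exact: bl_addr_ge0.
rewrite dualD lerD//; apply: le_trans (labsE _ _ _) _ => //.
  by apply: dual_mono => //; exact: leUl.
by apply: dual_mono => //; exact: leUr.
Qed.

End Ideals.

Theorem theorem2p1 (R : realType) (E : banachLatticeType R) :
  [/\ order_continuous_norm (dual E) -> un_dual E = [set: dual E],
      order_ideal (un_dual E) &
      AM_space E -> AL_subspace (un_dual E)].
Proof.
have idE := un_dual_ideal E; split=> // [ocn|AM].
  by apply/seteqP; split=> // f _; exact: ocn_un_dual.
split; last by move=> f g _ _; exact: AM_space_dual_normD.
split; first exact: un_dual_subspace.
- by move=> f g; exact: order_ideal_join.
- by move=> f g; exact: order_ideal_meet.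
(* The limit exists in the complete space [dual E], and closedness places it in the un-dual. *)
- move=> F FF FA /dual_complete Fc; exists (lim F) => //.
  exact: un_dual_closed Fc.
Qed.
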